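(* For every integer $r\ge 2$, the search problem weak-Turán$_r$ is $\mathsf{PWPP}$-hard; that is, every problem in $\mathsf{PWPP}$ is polynomial-time reducible to weak-Turán$_r$.
   Context: Search problems. A search problem is a binary relation $R\subseteq\{0,1\}^*\times\{0,1\}^*$; $s$ is a solution of instance $x$ if $(x,s)\in R$. It is total if every instance has a solution. $\mathsf{TFNP}$ is the class of total search problems whose relation is decidable in deterministic polynomial time and in which every instance has a solution of length polynomial in the instance size. Problems are specified by their valid (polynomial-time recognizable) instances; for an invalid instance every string is a solution by convention. $R$ is (polynomial-time) reducible to $S$ if there are polynomial-time functions $f,g$ such that for all $x,s$: if $s$ is a solution of $f(x)$ for $S$ then $g(x,s)$ is a solution of $x$ for $R$. weak-Pigeon: an instance is a Boolean circuit $C:\{0,1\}^n\to\{0,1\}^{n-1}$; a solution is a pair $x_1\ne x_2$ with $C(x_1)=C(x_2)$. $\mathsf{PWPP}$ is the class of all $\mathsf{TFNP}$ problems reducible to weak-Pigeon. weak-Turán$_r$ ($r$ a fixed constant): an instance is a Boolean circuit $C:\{0,1\}^{2n-1}\to\{0,1\}^n\times\{0,1\}^n$ ($n$ a positive integer, part of the instance); $C(i)=(u,v)$ is viewed as the edge between $u$ and $v$ in a graph with vertex set $\{0,1\}^n$. A solution is one of: (i) distinct $i_1,\dots,i_{r(r+1)/2}$ such that $C(i_1),\dots,C(i_{r(r+1)/2})$ are the edges of an $(r+1)$-clique; (ii) $i$ such that $C(i)=(u,v)$ with $u\ge v$ in the lexicographic order; (iii) $i\ne j$ such that $C(i)=C(j)$.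 *)

(* Defs.v *)
From HB Require Import structures.
From mathcomp Require Import all_boot all_order all_algebra.

Set Implicit Arguments.
Unset Strict Implicit.
Unset Printing Implicit Defensive.

Notation bits := (seq bool).

(* The tape alphabet is {0, 1, blank}, the blank being None. *)
Notation symbol := (option bool).

Inductive direction := MoveLeft | Stay | MoveRight.

(* A two-way infinite tape, in coordinates relative to its head: the head     *)
(* always scans cell 0, and moving the head shifts the contents.              *)
Definition tape := int -> symbol.

Definition write_tape (a : symbol) (t : tape) : tape :=
  fun z => if z == 0%R then a else t z.

Definition move_tape (d : direction) (t : tape) : tape :=
  match d with
  | MoveLeft => fun z => t (z - 1)%R
  | Stay => t
  | MoveRight => fun z => t (z + 1)%R
  end.

(* A string on a blank tape, with the head on its first letter. *)
Definition input_tape (x : bits) : tape :=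
  fun z => if z is Posz i then onth x i else None.

(* The output is the string between the head and the first blank to its       *)
(* right; the rest of the tape is ignored.                                    *)
Definition output_on (t : tape) (y : bits) : Prop :=
  forall i : nat, i <= size y -> t (Posz i) = onth y i.

(* Machines with k tapes; the transition function returns None to halt, and   *)
(* otherwise the next state and, for each tape, the symbol to be written and  *)
(* the move of the head.                                                      *)
Record machine (k : nat) := Machine {
  state : finType;
  start : state;
  delta : state -> {ffun 'I_k -> symbol} ->
          option (state * ('I_k -> symbol * direction))
}.

Section Execution.
Variables (k : nat) (M : machine k).

Definition config : Type := (state M * ('I_k -> tape))%type.

Definition step (c : config) : option config :=
  if delta c.1 [ffun j => c.2 j 0%R] is Some (q, act)
  then Some (q, fun j => move_tape (act j).2 (write_tape (act j).1 (c.2 j)))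
  else None.

(* The configuration after t steps; a halted machine stays put. *)
Definition run (t : nat) (c : config) : config :=
  iter t (fun c => odflt c (step c)) c.

(* The j-th argument is written on tape j, the other tapes being blank. *)
Definition init (xs : seq bits) : config :=
  (start M, fun j : 'I_k => input_tape (nth [::] xs j)).

End Execution.

Definition computes_within (k : nat) (M : machine k.+1)
    (xs : seq bits) (y : bits) (t : nat) : Prop :=
  let c := run t (init M xs) in step c = None /\ output_on (c.2 ord0) y.

Definition polytime1 (f : bits -> bits) : Prop :=
  exists (k : nat) (M : machine k.+1) (p : {poly nat}),
    forall x : bits, computes_within M [:: x] (f x) p.[size x]%R.

(* Two arguments are given on two separate tapes, hence at least 2 tapes. *)
Definition polytime2 (g : bits -> bits -> bits) : Prop :=
  exists (k : nat) (M : machine k.+2) (p : {poly nat}),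
    forall x s : bits,
      computes_within M [:: x; s] (g x s) p.[size x + size s]%R.

Definition polytime_decidable (R : bits -> bits -> Prop) : Prop :=
  exists2 chi : bits -> bits -> bits,
    polytime2 chi & forall x s, R x s <-> chi x s = [:: true].

Definition search_problem := bits -> bits -> Prop.

Definition total_problem (R : search_problem) : Prop := forall x, exists s, R x s.

Definition TFNP (R : search_problem) : Prop :=
  [/\ total_problem R, polytime_decidable R &
      exists p : {poly nat},
        forall x, exists2 s, R x s & size s <= p.[size x]%R].

Definition reducible (R S : search_problem) : Prop :=
  exists (f : bits -> bits) (g : bits -> bits -> bits),
    [/\ polytime1 f, polytime2 g & forall x s, S (f x) s -> R x (g x s)].

(* Gates name the wires that they read.  A circuit with n inputs has wires    *)
(* 0, .., n-1 for its inputs, and wire n + j for its j-th gate.               *)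
Inductive gate :=
  | Const of bool
  | Not of nat
  | And of nat & nat
  | Or of nat & nat.

Record circuit := Circuit {
  inputs : nat;
  gates : seq gate;
  outputs : seq nat
}.

Definition gate_wires (g : gate) : seq nat :=
  match g with
  | Const _ => [::]
  | Not a => [:: a]
  | And a b | Or a b => [:: a; b]
  end.

(* Each gate reads only wires preceding its own. *)
Fixpoint wf_gates (w : nat) (gs : seq gate) : bool :=
  if gs is g :: gs' then all (fun a => a < w) (gate_wires g) && wf_gates w.+1 gs'
  else true.

Definition wf_circuit (C : circuit) : bool :=
  wf_gates (inputs C) (gates C) &&
  all (fun a => a < inputs C + size (gates C)) (outputs C).

(* C is a circuit {0,1}^n -> {0,1}^m. *)
Definition is_circuit (C : circuit) (n m : nat) : bool :=
  [&& wf_circuit C, inputs C == n & size (outputs C) == m].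

Definition eval_gate (ws : seq bool) (g : gate) : bool :=
  match g with
  | Const b => b
  | Not a => ~~ nth false ws a
  | And a b => nth false ws a && nth false ws b
  | Or a b => nth false ws a || nth false ws b
  end.

Definition wire_values (gs : seq gate) (x : bits) : seq bool :=
  foldl (fun ws g => rcons ws (eval_gate ws g)) x gs.

Definition eval_circuit (C : circuit) (x : bits) : bits :=
  [seq nth false (wire_values (gates C) x) a | a <- outputs C].

(* Wire names are in unary, so that the encoding has length at most quadratic *)
(* in the number of wires and outputs; lists are encoded by preceding each    *)
(* item with 1 and ending with 0.                                             *)
Definition encode_nat (n : nat) : bits := rcons (nseq n true) false.

Definition encode_seq (T : Type) (enc : T -> bits) (s : seq T) : bits :=
  rcons (flatten [seq true :: enc a | a <- s]) false.

Definition encode_gate (g : gate) : bits :=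
  match g with
  | Const b => [:: false; false; b]
  | Not a => [:: false; true] ++ encode_nat a
  | And a b => [:: true; false] ++ encode_nat a ++ encode_nat b
  | Or a b => [:: true; true] ++ encode_nat a ++ encode_nat b
  end.

Definition encode (C : circuit) : bits :=
  encode_nat (inputs C) ++ encode_seq encode_gate (gates C)
    ++ encode_seq encode_nat (outputs C).

Lemma encode_nat_inj n1 n2 (r1 r2 : bits) :
  encode_nat n1 ++ r1 = encode_nat n2 ++ r2 -> n1 = n2 /\ r1 = r2.
Proof.
elim: n1 n2 => [|n1 IH] [|n2] //=; first by case.
by case=> /IH[-> ->].
Qed.

Lemma encode_gate_inj g1 g2 (r1 r2 : bits) :
  encode_gate g1 ++ r1 = encode_gate g2 ++ r2 -> g1 = g2 /\ r1 = r2.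
Proof.
case: g1 g2 => [b|a|a b|a b] [b'|a'|a' b'|a' b'] //=.
- by case=> -> ->.
- by case=> /encode_nat_inj[-> ->].
- by case; rewrite -!catA => /encode_nat_inj[-> /encode_nat_inj[-> ->]].
- by case; rewrite -!catA => /encode_nat_inj[-> /encode_nat_inj[-> ->]].
Qed.

Lemma encode_seq_inj (T : Type) (enc : T -> bits) :
    (forall a1 a2 r1 r2, enc a1 ++ r1 = enc a2 ++ r2 -> a1 = a2 /\ r1 = r2) ->
  forall s1 s2 r1 r2, encode_seq enc s1 ++ r1 = encode_seq enc s2 ++ r2 ->
  s1 = s2 /\ r1 = r2.
Proof.
move=> enc_inj; elim=> [|a1 s1 IH] [|a2 s2] r1 r2 //=; first by case.
rewrite /encode_seq /= !rcons_cat -!catA => -[] /enc_inj[->].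
by move/IH=> [-> ->].
Qed.

Lemma encode_inj : injective encode.
Proof.
move=> [n1 g1 o1] [n2 g2 o2]; rewrite /encode /=.
move=> /encode_nat_inj[-> /(encode_seq_inj encode_gate_inj)[->]].
rewrite -[LHS]cats0 -[RHS]cats0.
by move=> /(encode_seq_inj encode_nat_inj)[->].
Qed.

(* If x does not encode a circuit of the required shape then every s is a     *)
(* solution.  A pair of strings of length n is represented by their           *)
(* concatenation.                                                             *)
Definition weak_pigeon : search_problem := fun x s =>
  forall (n : nat) (C : circuit),
    0 < n -> is_circuit C n (n - 1) -> x = encode C ->
  exists x1 x2 : bits,
    [/\ s = x1 ++ x2, size x1 = n, size x2 = n, x1 != x2
      & eval_circuit C x1 = eval_circuit C x2].

Definition PWPP (R : search_problem) : Prop :=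
  TFNP R /\ reducible R weak_pigeon.

Definition PWPP_hard (S : search_problem) : Prop :=
  forall R : search_problem, PWPP R -> reducible R S.

(* The pairs in es, up to orientation, are the edges of a clique on k         *)
(* vertices.                                                                  *)
Definition edges_of_clique (T : eqType) (k : nat) (es : seq (T * T)) : Prop :=
  exists K : seq T,
    [/\ uniq K, size K = k,
        forall e, e \in es -> [/\ e.1 \in K, e.2 \in K & e.1 != e.2]
      & forall u v, u \in K -> v \in K -> u != v ->
          (u, v) \in es \/ (v, u) \in es].

(* The output of C on i, for C a circuit with 2n outputs. *)
Definition edge (n : nat) (C : circuit) (i : bits) : bits * bits :=
  (take n (eval_circuit C i), drop n (eval_circuit C i)).

(* A solution is a concatenation of indices, each of length 2n - 1; for       *)
(* r >= 2 the number of indices determines the kind of the solution.          *)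
Definition weak_turan (r : nat) : search_problem := fun x s =>
  forall (n : nat) (C : circuit),
    0 < n -> is_circuit C (2 * n - 1) (2 * n) -> x = encode C ->
  [\/ exists idx : seq bits,
        [/\ s = flatten idx,
            all (fun i => size i == 2 * n - 1) idx,
            size idx = r * (r + 1) %/ 2, uniq idx
          & edges_of_clique (r + 1) [seq edge n C i | i <- idx]],
      exists i : bits,
        [/\ s = i, size i = 2 * n - 1 &
            ((edge n C i).2 <= (edge n C i).1 :> seqlexi bool)%O]
    | exists i j : bits,
        [/\ s = i ++ j, size i = 2 * n - 1, size j = 2 * n - 1, i != j
          & edge n C i = edge n C j]].

(* Main.v *)
(* A circuit C from n to n - 1 bits becomes the circuit on 2n - 1 bits that    *)
(* maps the concatenation of y and x, where y has n - 1 bits and x has n, to   *)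
(* the edge between 0 C(x) and 1 y^rev.  All edges go from strings starting    *)
(* with 0 to strings starting with 1, so the graph is bipartite, without       *)
(* triangles, and each edge is increasing; a solution can only be a collision, *)
(* and it yields a collision of C once the y-parts are dropped.                *)
(*                                                                             *)
(* On encodings, C is translated by adding n - 1 to every wire name, and by    *)
(* appending two constant gates.  Since the inputs x come after y, this needs  *)
(* a single pass over the encoding with two unary counters.                    *)

Require Import Defs.
From Stdlib Require Import FunctionalExtensionality ClassicalEpsilon.
From mathcomp Require Import all_boot all_order all_algebra zify.

Set Implicit Arguments.
Unset Strict Implicit.
Unset Printing Implicit Defensive.

(** * Runs of machines *)

(** A circuit C from n to n - 1 bits yields a graph whose edge at the index y x, with |y| = n - 1
    and |x| = n, joins 0 C(x) to 1 rev(y). The graph is bipartite and its edges increase, so it has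
    no clique on r + 1 >= 3 vertices and no edge with u >= v: every solution is a collision. Equal
    edges have equal y, hence distinct x with the same image under C, and forgetting y gives a
    solution of weak-Pigeon. This is carried by [eval_turan_circuit], [is_circuit_turan] and
    [extract_cat].

    Most of the work is to realize both maps in polynomial time on concrete machines. Machines are
    built from a few combinators and specified by [exec], which views each tape as a stack and
    carries a time bound. [polytime1_reduction] translates encodings of circuits, and
    [polytime1_extract] drops the y-parts. [polytime1_comp] and [polytime2_comp] attach the two to
    the given reduction to weak-Pigeon; they rest on [computes_within_size], which bounds an
    intermediate string by the input length and the time spent on it. *)

Fixpoint steps (k : nat) (M : machine k) (n : nat) (c c' : config M) : Prop :=
  if n is n'.+1 then exists2 c1, step c = Some c1 & steps n' c1 c' else c = c'.

(** The initial tapes are arbitrary and t is only an upper bound, so that specifications can be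
    chained and their times added. *)
Definition halts (k : nat) (M : machine k) (T T' : 'I_k -> tape) (t : nat) :=
  exists n q, [/\ n <= t, steps n (start M, T) (q, T') & step (q, T') = None].

Lemma steps_cat k (M : machine k) n m (c c1 c2 : config M) :
  steps n c c1 -> steps m c1 c2 -> steps (n + m) c c2.
Proof.
elim: n c => [|n IH] c /=; first by move->.
by case=> c3 E H /(IH _ H) H'; exists c3.
Qed.

Lemma steps1 k (M : machine k) (c c' : config M) : step c = Some c' -> steps 1 c c'.
Proof. by move=> E; exists c'. Qed.

Lemma steps_sim k k' (M : machine k) (M' : machine k') (phi : config M -> config M') :
    (forall c c', step c = Some c' -> step (phi c) = Some (phi c')) ->
  forall n c c', steps n c c' -> steps n (phi c) (phi c').
Proof.
move=> sim; elim=> [|n IH] c c' /=; first by move->.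
by case=> c1 /sim E /IH H; exists (phi c1).
Qed.

Lemma run_halted k (M : machine k) n (c : config M) : step c = None -> run n c = c.
Proof. by move=> E; elim: n => //= n; rewrite /run /= => ->; rewrite E. Qed.

Lemma run_steps k (M : machine k) t (c : config M) :
  step (run t c) = None -> exists2 n, n <= t & steps n c (run t c).
Proof.
elim: t c => [|t IH] c; first by exists 0.
rewrite /run iterSr -/(run t _); case E: (step c) => [c1|] /=.
  by move=> /IH[n le_nt H]; exists n.+1 => //; exists c1.
by move=> _; exists 0; rewrite //= run_halted.
Qed.

Lemma steps_run k (M : machine k) n t (c c' : config M) :
  steps n c c' -> step c' = None -> n <= t -> run t c = c'.
Proof.
elim: n t c => [|n IH] t c /=; first by move=> -> E _; apply: run_halted.
case=> c1 E H Hc'; case: t => // t le_nt.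
by rewrite /run iterSr -/(run t _) E; apply: IH.
Qed.

Lemma computes_withinP k (M : machine k.+1) xs y t :
  computes_within M xs y t <->
  exists2 T', halts M (fun j => input_tape (nth [::] xs j)) T' t
            & output_on (T' ord0) y.
Proof.
split=> [[H out]|[T' [n [q [le_nt H Hq]]] out]].
  case: (run_steps H) => n le_nt Hn.
  exists (run t (init M xs)).2 => //.
  by exists n, (run t (init M xs)).1; split; rewrite -?surjective_pairing.
by rewrite /computes_within (steps_run H Hq le_nt).
Qed.

Lemma halts_leq k (M : machine k) T T' t t' : halts M T T' t -> t <= t' -> halts M T T' t'.
Proof.
by case=> n [q [le_nt H Hq]] le_tt'; exists n, q; split=> //; apply: leq_trans le_tt'.
Qed.

(* Each step moves the head by at most one cell, and writes below it. *)
Lemma steps_space k (M : machine k) n B (c c' : config M) (j : 'I_k) :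
  steps n c c' -> (forall i : nat, B < i -> c.2 j (Posz i) = None) ->
  forall i : nat, B + n < i -> c'.2 j (Posz i) = None.
Proof.
elim: n B c => [|n IH] B c /=; first by move=> <- H i; rewrite addn0; apply: H.
case=> c1 E Hs H i lt_i; apply: (IH B.+1) Hs _ _ _; last by rewrite addSnnS.
move=> {lt_i}i lt_i; move: E; rewrite /step; case: (delta _ _) => // -[q a] [<-] /=.
rewrite /write_tape; case: (a j).2 => /=.
- have -> : (Posz i - 1)%R = Posz i.-1 by lia.
  by case: eqP; [lia | move=> _; apply: H; lia].
- by case: eqP; [lia | move=> _; apply: H; lia].
- have -> : (Posz i + 1)%R = Posz i.+1 by lia.
  by case: eqP; [lia | move=> _; apply: H; lia].
Qed.

Lemma output_on_size t y B :
  output_on t y -> (forall i : nat, B < i -> t (Posz i) = None) -> size y <= B.+1.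
Proof.
move=> out H; rewrite leqNgt; apply/negP=> lt_y.
have := out (size y).-1 (leq_pred _); rewrite H; last lia.
have := onthTE y (size y).-1; case: (onth _ _) => //=; lia.
Qed.

Lemma input_tape_blank s (i : nat) : size s < i -> input_tape s (Posz i) = None.
Proof. by move=> lt_i /=; apply: onth_default; apply: ltnW. Qed.

Lemma computes_within_size k (M : machine k.+1) xs y t :
  computes_within M xs y t -> size y <= size (nth [::] xs 0) + t.+1.
Proof.
case/computes_withinP=> T' [n [q [le_nt H _]]] /output_on_size.
move/(_ (size (nth [::] xs 0) + n)) => le_y; apply: leq_trans (le_y _) _; last lia.
by apply: (steps_space (j := ord0) H) => i; apply: input_tape_blank.
Qed.

(** * Combining machines *)

(** The action of a pure change of state: every scanned symbol is written back. The combinators use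
    it to pass control. *)
Definition keep k (v : {ffun 'I_k -> symbol}) : 'I_k -> symbol * direction :=
  fun j => (v j, Stay).

Lemma keep_tapes k (T : 'I_k -> tape) :
  (fun j => move_tape (keep [ffun i => T i 0%R] j).2
              (write_tape (keep [ffun i => T i 0%R] j).1 (T j))) = T.
Proof.
apply: functional_extensionality => j; apply: functional_extensionality => z.
by rewrite /= /write_tape ffunE; case: eqP => // ->.
Qed.

Section Combinators.
Variable k : nat.
Implicit Types (M : machine k) (T : 'I_k -> tape) (test : {ffun 'I_k -> symbol} -> bool).

Definition seqM M1 M2 : machine k := @Machine k (state M1 + state M2)%type
  (inl (start M1))
  (fun q v => match q with
    | inl q1 => if delta q1 v is Some (q', a) then Some (inl q', a)
                else Some (inr (start M2), keep v)
    | inr q2 => if delta q2 v is Some (q', a) then Some (inr q', a) else None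
    end).

Definition ifM test M1 M2 : machine k := @Machine k (option (state M1 + state M2))
  None
  (fun q v => match q with
    | None => Some (Some (if test v then inl (start M1) else inr (start M2)), keep v)
    | Some (inl q1) =>
        if delta q1 v is Some (q', a) then Some (Some (inl q'), a) else None
    | Some (inr q2) =>
        if delta q2 v is Some (q', a) then Some (Some (inr q'), a) else None
    end).

(** [None] is the state that tests; when [M] halts, control returns to it. *)
Definition whileM test M : machine k := @Machine k (option (state M))
  None
  (fun q v => match q with
    | None => if test v then Some (Some (start M), keep v) else None
    | Some q1 => if delta q1 v is Some (q', a) then Some (Some q', a)
                 else Some (None, keep v)
    end).

Definition actM (act : {ffun 'I_k -> symbol} -> 'I_k -> symbol * direction) : machine k :=
  @Machine k bool false (fun q v => if q then None else Some (true, act v)).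

Definition heads T : {ffun 'I_k -> symbol} := [ffun j => T j 0%R].

Lemma halts_seq M1 M2 T T1 T2 t1 t2 :
  halts M1 T T1 t1 -> halts M2 T1 T2 t2 -> halts (seqM M1 M2) T T2 (t1 + t2 + 1).
Proof.
case=> n1 [q1 [le1 H1 E1]] [n2 [q2 [le2 H2 E2]]].
exists (n1 + (1 + n2)), (inr q2); split; first lia.
- apply: (@steps_cat _ (seqM M1 M2) _ _ _ (inl q1, T1)).
    pose phi (c : config M1) : config (seqM M1 M2) := (inl c.1, c.2).
    apply: (@steps_sim _ _ _ _ phi _ _ _ _ H1) => c c'.
    by rewrite /step /=; case: (delta _ _) => // -[q a] [<-].
  apply: (@steps_cat _ (seqM M1 M2) _ _ _ (inr (start M2), T1)).
    apply: steps1; move: E1; rewrite /step /=.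
    by case: (delta _ _) => [[]|] // _; rewrite keep_tapes.
  pose phi (c : config M2) : config (seqM M1 M2) := (inr c.1, c.2).
  apply: (@steps_sim _ _ _ _ phi _ _ _ _ H2) => c c'.
  by rewrite /step /=; case: (delta _ _) => // -[q a] [<-].
- by move: E2; rewrite /step /=; case: (delta _ _) => // -[].
Qed.

Lemma halts_if test M1 M2 T T' t :
  halts (if test (heads T) then M1 else M2) T T' t -> halts (ifM test M1 M2) T T' t.+1.
Proof.
case E: (test _) => -[n [q [le H Eq]]].
  exists (1 + n), (Some (inl q)); split=> //.
    apply: (@steps_cat _ (ifM test M1 M2) _ _ _ (Some (inl (start M1)), T)).
      by apply: steps1; rewrite /step /= -/(heads T) E keep_tapes.
    pose phi (c : config M1) : config (ifM test M1 M2) := (Some (inl c.1), c.2).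
    apply: (@steps_sim _ _ _ _ phi _ _ _ _ H) => c c'.
    by rewrite /step /=; case: (delta _ _) => // -[q' a] [<-].
  by move: Eq; rewrite /step /=; case: (delta _ _) => // -[].
exists (1 + n), (Some (inr q)); split=> //.
  apply: (@steps_cat _ (ifM test M1 M2) _ _ _ (Some (inr (start M2)), T)).
    by apply: steps1; rewrite /step /= -/(heads T) E keep_tapes.
  pose phi (c : config M2) : config (ifM test M1 M2) := (Some (inr c.1), c.2).
  apply: (@steps_sim _ _ _ _ phi _ _ _ _ H) => c c'.
  by rewrite /step /=; case: (delta _ _) => // -[q' a] [<-].
by move: Eq; rewrite /step /=; case: (delta _ _) => // -[].
Qed.

Lemma halts_while_done test M T : ~~ test (heads T) -> halts (whileM test M) T T 0.
Proof.
by move/negbTE=> E; exists 0, None; split; rewrite // /step /= -/(heads T) E.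
Qed.

Lemma halts_while_step test M T T1 T2 t1 t2 :
  test (heads T) -> halts M T T1 t1 -> halts (whileM test M) T1 T2 t2 ->
  halts (whileM test M) T T2 (t1 + t2 + 2).
Proof.
move=> E [n1 [q1 [le1 H1 E1]]] [n2 [q2 [le2 H2 E2]]].
exists (1 + (n1 + (1 + n2))), q2; split=> //; first lia.
apply: (@steps_cat _ (whileM test M) _ _ _ (Some (start M), T)).
  by apply: steps1; rewrite /step /= -/(heads T) E keep_tapes.
apply: (@steps_cat _ (whileM test M) _ _ _ (Some q1, T1)).
  pose phi (c : config M) : config (whileM test M) := (Some c.1, c.2).
  apply: (@steps_sim _ _ _ _ phi _ _ _ _ H1) => c c'.
  by rewrite /step /=; case: (delta _ _) => // -[q' a] [<-].
apply: steps_cat H2; apply: steps1; move: E1; rewrite /step /=.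
by case: (delta _ _) => [[]|] // _; rewrite keep_tapes.
Qed.

Lemma halts_act act T :
  halts (actM act) T
    (fun j => move_tape (act (heads T) j).2 (write_tape (act (heads T) j).1 (T j))) 1.
Proof. by exists 1, true; split=> //; apply: steps1. Qed.

End Combinators.

Section Embed.
Variables (k K : nat) (e : 'I_k -> 'I_K).

(** For running a machine on selected tapes of a larger one: tapes outside the image of [e] keep
    their content. *)
Definition merge (A : Type) (U : 'I_K -> A) (T : 'I_k -> A) : 'I_K -> A :=
  fun i => if [pick j | e j == i] is Some j then T j else U i.

Definition embed (M : machine k) : machine K := @Machine K (state M) (start M)
  (fun q v => if delta q [ffun j => v (e j)] is Some (q', a)
              then Some (q', merge (keep v) a) else None).

Hypothesis e_inj : injective e.

Lemma mergeE A (U : 'I_K -> A) T j : merge U T (e j) = T j.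
Proof. by rewrite /merge; case: pickP => [j' /eqP/e_inj-> //|/(_ j)]; rewrite eqxx. Qed.

Lemma merge_out A (U : 'I_K -> A) T i : (forall j, e j != i) -> merge U T i = U i.
Proof. by rewrite /merge; case: pickP => // j /eqP<- /(_ j); rewrite eqxx. Qed.

Lemma halts_embed M U T' t :
  halts M (fun j => U (e j)) T' t -> halts (embed M) U (merge U T') t.
Proof.
case=> n [q [le_nt H Eq]].
have readE (T : 'I_k -> tape) : [ffun j => [ffun i => merge U T i 0%R] (e j)] = heads T.
  by apply/ffunP=> j; rewrite !ffunE mergeE.
exists n, q; split=> //.
  (* This puts the initial configuration in the image of [phi], as [steps_sim] requires. *)
  have {1}-> : U = merge U (fun j => U (e j)).
    apply: functional_extensionality => i.
    by rewrite /merge; case: pickP => // j /eqP<-.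
  pose phi (c : config M) : config (embed M) := (c.1, merge U c.2).
  apply: (@steps_sim _ _ _ _ phi _ _ _ _ H) => -[p T] c' /=.
  rewrite /step /= readE -/(heads T); case: (delta _ _) => // -[q' a] [<-].
  congr (Some (_, _)); apply: functional_extensionality => i.
  rewrite /merge; case: pickP => //= nej; apply: functional_extensionality => z.
  by rewrite /write_tape !ffunE; case: pickP => [j|_]; [rewrite nej | case: eqP => // ->].
by move: Eq; rewrite /step /= readE -/(heads T'); case: (delta _ _) => // -[].
Qed.

End Embed.
(** * Tapes as stacks *)

Section Stacks.
Variable k : nat.
Implicit Types (M P Q : machine k.+1) (S : seq bits) (T : 'I_k.+1 -> tape) (j : nat).

Definition top (S : seq bits) (j : nat) : symbol := ohead (nth [::] S j).

Definition upd (S : seq bits) (j : nat) (s : bits) : seq bits := set_nth [::] S j s.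

Lemma nth_upd S j s l : nth [::] (upd S j s) l = if l == j then s else nth [::] S l.
Proof. by rewrite nth_set_nth. Qed.

(* [exact j] requires tape j to be blank outside of its stack; otherwise the  *)
(* cells left of the head, and those beyond the first blank, are arbitrary.   *)
Definition stacks (exact : pred 'I_k.+1) T S : Prop := forall j : 'I_k.+1,
  if exact j then T j = input_tape (nth [::] S j) else output_on (T j) (nth [::] S j).

(** Since [exact] is arbitrary, one specification covers both tapes known to be blank elsewhere and
    tapes on which another machine may have left garbage. *)
Definition exec M S S' (t : nat) : Prop := forall exact T,
  stacks exact T S -> exists2 T', stacks exact T' S' & halts M T T' t.

Lemma stacks_top exact T S (j : 'I_k.+1) : stacks exact T S -> T j 0%R = top S j.
Proof.
move/(_ j); case: (exact j); first by move->; rewrite /top; case: (nth _ _ _).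
by move/(_ 0 (leq0n _)); rewrite /top; case: (nth _ _ _).
Qed.

Lemma exec_leq M S S' t t' : exec M S S' t -> t <= t' -> exec M S S' t'.
Proof. by move=> H le_tt' x T /H[T' HT' /halts_leq HM]; exists T'; last apply: HM. Qed.

Lemma exec_eq M S S' S'' t :
  exec M S S' t -> (forall j, nth [::] S' j = nth [::] S'' j) -> exec M S S'' t.
Proof. by move=> H E x T /H[T' HT' hM]; exists T' => // j; rewrite -E; apply: HT'. Qed.

Lemma exec_seq P Q S S1 S2 t1 t2 :
  exec P S S1 t1 -> exec Q S1 S2 t2 -> exec (seqM P Q) S S2 (t1 + t2 + 1).
Proof.
move=> HP HQ x T /HP[T1 /HQ[T2 H2 hQ] hP]; exists T2 => //; exact: halts_seq hP hQ.
Qed.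

Definition test_top (j : nat) (a : pred symbol) : {ffun 'I_k.+1 -> symbol} -> bool :=
  fun v => a (v (inord j)).

Lemma test_topE exact T S j a : j < k.+1 ->
  stacks exact T S -> test_top j a (heads T) = a (top S j).
Proof. by move=> lt_j /stacks_top E; rewrite /test_top ffunE E inordK. Qed.

Lemma exec_if j (a : pred symbol) P Q S S' t : j < k.+1 ->
  exec (if a (top S j) then P else Q) S S' t -> exec (ifM (test_top j a) P Q) S S' t.+1.
Proof.
move=> lt_j H x T HT; case: (H x T HT) => T' HT' h; exists T' => //.
by apply: halts_if; rewrite (test_topE a lt_j HT).
Qed.

Lemma exec_while_done j (a : pred symbol) P S : j < k.+1 ->
  ~~ a (top S j) -> exec (whileM (test_top j a) P) S S 0.
Proof.
move=> lt_j H x T HT; exists T => //.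
by apply: halts_while_done; rewrite (test_topE a lt_j HT).
Qed.

Lemma exec_while_step j (a : pred symbol) P S S1 S2 t1 t2 : j < k.+1 ->
  a (top S j) -> exec P S S1 t1 -> exec (whileM (test_top j a) P) S1 S2 t2 ->
  exec (whileM (test_top j a) P) S S2 (t1 + t2 + 2).
Proof.
move=> lt_j H HP HQ x T HT; case: (HP x T HT) => T1 /HQ[T2 H2 h2] h1; exists T2 => //.
by apply: halts_while_step h1 h2; rewrite (test_topE a lt_j HT).
Qed.

Definition actj (j : nat) (g : symbol -> symbol * direction) : machine k.+1 :=
  actM (fun v i => if val i == j then g (v i) else keep v i).

Definition act_tape (g : symbol -> symbol * direction) (t : tape) : tape :=
  move_tape (g (t 0%R)).2 (write_tape (g (t 0%R)).1 t).

Lemma halts_actj j g T :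
  halts (actj j g) T (fun i => if val i == j then act_tape g (T i) else T i) 1.
Proof.
have := halts_act (fun v i => if val i == j then g (v i) else keep v i) T.
congr halts; apply: functional_extensionality => i; rewrite /heads.
case: eqP => // _; first by rewrite ffunE.
by apply: functional_extensionality => z; rewrite /= /write_tape ffunE; case: eqP => // ->.
Qed.

(** The popped cell is erased, so that an exact tape stays blank to the left of its stack. *)
Definition pop j : machine k.+1 :=
  actj j (fun a => if a is Some _ then (None, MoveRight) else (None, Stay)).

(** Two actions are needed because a step writes before it moves. *)
Definition push j (b : bool) : machine k.+1 :=
  seqM (actj j (fun a => (a, MoveLeft))) (actj j (fun=> (Some b, Stay))).

Definition skip : machine k.+1 := actM (@keep _).

Lemma exec_skip S : exec skip S S 1.
Proof.
by move=> x T HT; exists T => //; have := halts_act (@keep _) T; rewrite keep_tapes.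
Qed.

Lemma exec_pop j S : exec (pop j) S (upd S j (behead (nth [::] S j))) 1.
Proof.
move=> x T HT; eexists; last exact: halts_actj.
move=> i; rewrite nth_set_nth /=; case: eqP => [<-|_]; last exact: HT.
have := HT i; rewrite /act_tape (stacks_top i HT) /top; move: (T i) => t.
case: (nth _ _ _) => [|b s]; case: (x i) => //=.
- move=> ->; apply: functional_extensionality => z.
  by rewrite /write_tape; case: eqP => // ->.
- by move=> H i'; rewrite leqn0 => /eqP->; rewrite /= /write_tape.
- move=> ->; apply: functional_extensionality => -[z|[|z]] //.
  by have -> : (Posz z + 1)%R = Posz z.+1 by lia.
- move=> H i' le_i'; have -> : (Posz i' + 1)%R = Posz i'.+1 by lia.
  by rewrite /write_tape /= H.
Qed.

Lemma exec_push j b S : exec (push j b) S (upd S j (b :: nth [::] S j)) 3.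
Proof.
move=> x T HT; eexists; last by apply: (@halts_seq _ _ _ _ _ _ 1 1); apply: halts_actj.
move=> i; rewrite nth_set_nth /=; case: eqP => [<-|_]; last exact: HT.
have := HT i; rewrite /act_tape /=; move: (T i) => t.
case: (x i) => [->|H].
  apply: functional_extensionality => -[[|z]|z] //=; rewrite /write_tape.
    have -> : (Posz z.+1 - 1)%R = Posz z by lia.
    by case: z => //=; case: (nth _ _ _).
move=> [|i'] //= le_i'; rewrite /write_tape /=.
have -> : (Posz i'.+1 - 1)%R = Posz i' by lia.
by rewrite -H //; case: eqP => // ->.
Qed.

Definition move_top i j : machine k.+1 :=
  ifM (test_top i (eq_op^~ (Some true))) (seqM (pop i) (push j true))
    (ifM (test_top i (eq_op^~ (Some false))) (seqM (pop i) (push j false)) skip).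

Lemma exec_move_top i j S : i < k.+1 ->
  exec (move_top i j) S
    (if nth [::] S i is b :: s then upd (upd S i s) j (b :: nth [::] (upd S i s) j)
     else S) 7.
Proof.
move=> lt_i; apply: (exec_leq (t := (5.+1).+1)) => //; apply: exec_if => //=.
case E: (nth _ _ _) => [|[] s]; rewrite /top E /=.
- apply: (@exec_leq _ _ _ 2) => //; apply: exec_if => //.
  by rewrite /top E; apply: exec_skip.
- apply: (@exec_leq _ _ _ (1 + 3 + 1)) => //; apply: exec_seq; last exact: exec_push.
  by have := @exec_pop i S; rewrite E.
- apply: exec_if => //; rewrite /top E /=.
  apply: (@exec_leq _ _ _ (1 + 3 + 1)) => //; apply: exec_seq; last exact: exec_push.
  by have := @exec_pop i S; rewrite E.
Qed.

(** A stack grows no faster than the machine runs. This bounds results about which a specification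
    says nothing else. *)
Lemma exec_size M S S' t j : exec M S S' t -> j < k.+1 ->
  size (nth [::] S' j) <= size (nth [::] S j) + t.+1.
Proof.
move=> H lt_j; case: (H xpredT (fun i : 'I_k.+1 => input_tape (nth [::] S i))) => // T' HT'.
case=> n [q [le_nt Hs _]]; have := HT' (Ordinal lt_j); rewrite /= => E.
have out : output_on (T' (Ordinal lt_j)) (nth [::] S' j) by rewrite E.
apply: leq_trans (output_on_size (B := size (nth [::] S j) + n) out _) _; last lia.
by apply: (steps_space (j := Ordinal lt_j) Hs) => i; apply: input_tape_blank.
Qed.

Definition pour i j : machine k.+1 := whileM (test_top i isSome) (move_top i j).

Lemma exec_pour i j S : i < k.+1 -> i != j ->
  exec (pour i j) S (upd (upd S i [::]) j (catrev (nth [::] S i) (nth [::] S j)))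
    (9 * size (nth [::] S i)).
Proof.
move=> lt_i ne_ij.
move E: (nth [::] S i) => s; elim: s S E => [|b s IH] S E.
  apply: (exec_eq (S' := S)); first by apply: exec_while_done; rewrite // /top E.
  by move=> l; rewrite !nth_upd; do 2?case: eqP => [->|].
have := @exec_move_top i j S lt_i; rewrite E; set S1 := upd _ j _ => H1.
have E1 : nth [::] S1 i = s.
  by rewrite nth_upd (negbTE ne_ij) nth_upd eqxx.
have := IH S1 E1 => H2.
apply: (@exec_leq _ _ _ (7 + 9 * size s + 2)); last by rewrite /=; lia.
apply: (exec_while_step lt_i _ H1) => //; first by rewrite /top E.
apply: (exec_eq H2) => l; rewrite /S1 !nth_upd eqxx [j == i]eq_sym (negbTE ne_ij).
by case: eqP => // _; case: eqP.
Qed.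

End Stacks.

(** Each pour reverses the string, so two of them restore its order. *)
Definition transfer : machine 3 := seqM (pour 2 0 1) (pour 2 1 2).

Lemma exec_transfer y :
  exec transfer [:: y; [::]; [::]] [:: [::]; [::]; y] (18 * size y + 1).
Proof.
have H1 := @exec_pour 2 0 1 [:: y; [::]; [::]] isT isT.
have H2 := @exec_pour 2 1 2 [:: [::]; catrev y [::]; [::]] isT isT.
move: (exec_seq H1 H2); rewrite /= /upd /= -/(rev _) -/(rev _) revK size_rev => H.
by apply: exec_leq H _; lia.
Qed.

(** * Composition of polynomial-time functions *)

Section Composition.
Variables (a b : nat) (A : machine a.+1) (B : machine b.+1) (i : 'I_b.+1).
Local Notation K := (b.+1 + (a.+1 + 1)).

Definition tapeB (j : 'I_b.+1) : 'I_K := lshift _ j.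
Definition tapeA (j : 'I_a.+1) : 'I_K := rshift _ (lshift _ j).
Definition tape_tmp : 'I_K := rshift _ (rshift _ ord0).
Definition into_A (j : 'I_3) : 'I_K := nth (tapeB i) [:: tapeB i; tape_tmp; tapeA ord0] j.
Definition from_A (j : 'I_3) : 'I_K := nth (tapeB i) [:: tapeA ord0; tape_tmp; tapeB i] j.

(** The argument on tape [i] of [B] is moved to [A], and the result of [A] is moved back there.
    Whatever else [A] leaves behind lies on tapes that [B] never sees. *)
Definition compose : machine K :=
  seqM (embed into_A transfer)
    (seqM (embed tapeA A) (seqM (embed from_A transfer) (embed tapeB B))).

Lemma tapeB_inj : injective tapeB. Proof. exact: lshift_inj. Qed.
Lemma tapeA_inj : injective tapeA.
Proof. by move=> j j' /rshift_inj/lshift_inj. Qed.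

Lemma tapeAB j j' : (tapeA j == tapeB j') = false.
Proof. by apply/eqP=> /(congr1 val) /=; have := ltn_ord j'; lia. Qed.

Lemma tape_tmpA j : (tape_tmp == tapeA j) = false.
Proof. by apply/eqP=> /(congr1 val) /=; have := ltn_ord j; lia. Qed.

Lemma tape_tmpB j : (tape_tmp == tapeB j) = false.
Proof. by apply/eqP=> /(congr1 val) /=; have := ltn_ord j; lia. Qed.

Lemma into_A_inj : injective into_A.
Proof.
move=> [[|[|[|j]]] lt_j] [[|[|[|j']]] lt_j'] //= H; apply: val_inj => //=; move/eqP: H;
  by rewrite /into_A /= ?[tapeB i == _]eq_sym ?[tapeA _ == tape_tmp]eq_sym
     ?tapeAB ?tape_tmpA ?tape_tmpB.
Qed.

Lemma from_A_inj : injective from_A.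
Proof.
move=> [[|[|[|j]]] lt_j] [[|[|[|j']]] lt_j'] //= H; apply: val_inj => //=; move/eqP: H;
  by rewrite /from_A /= ?[tapeB i == _]eq_sym ?[tapeA _ == tape_tmp]eq_sym
     ?tapeAB ?tape_tmpA ?tape_tmpB.
Qed.

Definition ord30 : 'I_3 := @Ordinal 3 0 isT.
Definition ord31 : 'I_3 := @Ordinal 3 1 isT.
Definition ord32 : 'I_3 := @Ordinal 3 2 isT.

(** Used with [ex] true to carry the argument to [A], since the source must become blank to receive
    the result later, and with [ex] false to carry the result back, since the output tape of [A] may
    hold garbage. *)
Lemma halts_transfer (ex : bool) (e : 'I_3 -> 'I_K) U y : injective e ->
  (if ex then U (e ord30) = input_tape y else output_on (U (e ord30)) y) ->
  U (e ord31) = input_tape [::] -> U (e ord32) = input_tape [::] ->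
  exists T', [/\ halts (embed e transfer) U T' (18 * size y + 1),
    T' (e ord31) = input_tape [::], T' (e ord32) = input_tape y,
    (ex -> T' (e ord30) = input_tape [::])
    & forall l, (forall j, e j != l) -> T' l = U l].
Proof.
move=> e_inj U0 U1 U2.
pose x : pred 'I_3 := fun j => (val j != 0) || ex.
have HT : stacks x (fun j => U (e j)) [:: y; [::]; [::]].
  by move=> [[|[|[|j]]] lt_j] //=; rewrite (bool_irrelevance lt_j isT) /x /=.
case: (exec_transfer HT) => T'' H h; exists (merge e U T''); split.
- exact: halts_embed.
- by rewrite mergeE //; have := H ord31.
- by rewrite mergeE //; have := H ord32.
- by move=> Hex; rewrite mergeE //; have := H ord30; rewrite /x /= Hex.
- by move=> l Hl; apply: merge_out.
Qed.

Lemma computes_compose xs y z tA tB : size xs <= b.+1 ->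
  computes_within A [:: nth [::] xs i] y tA ->
  computes_within B (set_nth [::] xs i y) z tB ->
  computes_within (compose : machine (b + (a.+1 + 1)).+1) xs z
    (tA + tB + 18 * (size (nth [::] xs i) + size y) + 5).
Proof.
move=> le_xs /computes_withinP[TA hA outA] /computes_withinP[TB hB outB].
apply/computes_withinP.
pose U : 'I_K -> tape := fun j => input_tape (nth [::] xs j); rewrite -/U.
have blank_out (j : 'I_K) : b < j -> U j = input_tape [::].
  by move=> lt_j; rewrite /U nth_default //; apply: leq_trans le_xs _.
case: (@halts_transfer true into_A U (nth [::] xs i)) => [|//|||T1 [h1 T11 T12 T10 T1U]].
- exact: into_A_inj.
- by apply: blank_out; rewrite /= ltnS leq_addr.
- by apply: blank_out; rewrite /= ltnS leq_addr.
have {}T10 := T10 isT.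
have T1B (j : 'I_b.+1) : j != i -> T1 (tapeB j) = U (tapeB j).
  move=> ne_j; apply: T1U => -[[|[|[|l]]] lt_l] //=.
  - by rewrite /into_A /= (inj_eq tapeB_inj) eq_sym.
  - by rewrite /into_A /= tape_tmpB.
  - by rewrite /into_A /= tapeAB.
have E1 : (fun j => T1 (tapeA j))
    = fun j : 'I_a.+1 => input_tape (nth [::] [:: nth [::] xs i] j).
  apply: functional_extensionality => j; case: (eqVneq j ord0) => [->|ne_j].
    by rewrite -T12.
  rewrite T1U; first rewrite blank_out.
  - by case: j ne_j => -[|j] lt_j //=; rewrite nth_nil.
  - by rewrite /= ltnS leq_addr.
  move=> [[|[|[|l]]] lt_l] //=.
  - by rewrite /into_A /= eq_sym tapeAB.
  - by rewrite /into_A /= tape_tmpA.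
  - by rewrite /into_A /= (inj_eq tapeA_inj) eq_sym.
rewrite -E1 in hA; have h2 := halts_embed tapeA_inj hA.
set T2 := merge _ _ _ in h2.
have T2B j : T2 (tapeB j) = T1 (tapeB j).
  by apply: merge_out => l; rewrite tapeAB.
case: (@halts_transfer false from_A T2 y) => [||||T3 [h3 T31 T32 _ T3U]].
- exact: from_A_inj.
- by rewrite /= /from_A /= /T2 mergeE //; apply: tapeA_inj.
- by rewrite /from_A /= /T2 merge_out // => j; rewrite eq_sym tape_tmpA.
- by rewrite /from_A /= T2B.
have E3 : (fun j => T3 (tapeB j))
    = fun j : 'I_b.+1 => input_tape (nth [::] (set_nth [::] xs i y) j).
  apply: functional_extensionality => j; rewrite nth_set_nth /=.
  case: (eqVneq j i) => [->|ne_j]; first by rewrite eqxx -T32.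
  rewrite T3U; first by rewrite T2B T1B // ifN.
  move=> [[|[|[|l]]] lt_l] //=.
  - by rewrite /from_A /= tapeAB.
  - by rewrite /from_A /= tape_tmpB.
  - by rewrite /from_A /= (inj_eq tapeB_inj) eq_sym.
rewrite -E3 in hB; have h4 := halts_embed tapeB_inj hB.
exists (merge tapeB T3 TB).
  by apply: halts_leq (halts_seq h1 (halts_seq h2 (halts_seq h3 h4))) _; lia.
rewrite (_ : ord0 = tapeB ord0); last exact: val_inj.
by rewrite mergeE //; apply: tapeB_inj.
Qed.

End Composition.

(** Coefficients in [nat] are nonnegative, so every such polynomial is monotone. *)
Lemma horner_nat_leq (p : {poly nat}) (m n : nat) : m <= n -> p.[m]%R <= p.[n]%R.
Proof.
move=> le_mn; rewrite !horner_coef.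
apply: (big_ind2 leq) => // [x1 x2 y1 y2|j _]; first exact: leq_add.
apply: leq_mul => //; elim: (nat_of_ord j) => // l IH.
by rewrite !GRing.exprS; apply: leq_mul.
Qed.

Lemma computes_within_leq k (M : machine k.+1) xs y t t' :
  computes_within M xs y t -> t <= t' -> computes_within M xs y t'.
Proof.
move=> /computes_withinP[T' H out] le_tt'; apply/computes_withinP.
by exists T' => //; apply: halts_leq le_tt'.
Qed.

(** The inner polynomial X + p + 1 bounds the length of the intermediate string; the last two terms
    pay for the transfers and the changes of machine. *)
Definition comp_bound (p q : {poly nat}) : {poly nat} :=
  (p + (q \Po ('X + p + 1%:P)) + 18%:P * ('X + ('X + p + 1%:P)) + 5%:P)%R.

Lemma comp_boundE p q (n : nat) : (comp_bound p q).[n]%R =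
  p.[n]%R + q.[(n + p.[n]%R + 1)%N]%R + 18 * (n + (n + p.[n]%R + 1)) + 5 :> nat.
Proof. by rewrite !(hornerD, hornerM, horner_comp, hornerX, hornerC). Qed.

Lemma polytime1_comp f h :
  polytime1 f -> polytime1 h -> polytime1 (fun x => h (f x)).
Proof.
move=> [a [A [p HA]]] [b [B [q HB]]].
exists (b + (a.+1 + 1)), (compose A B ord0), (comp_bound p q) => x.
have le_f := computes_within_size (HA x).
have H := @computes_compose a b A B ord0 [:: x] (f x) _ _ _ isT (HA x) (HB (f x)).
apply: computes_within_leq H _; rewrite comp_boundE.
have /(horner_nat_leq q) : size (f x) <= size x + p.[size x]%R + 1 by move: le_f => /=; lia.
move: le_f => /=; lia.
Qed.

Lemma polytime2_comp g h :
  polytime2 g -> polytime1 h -> polytime2 (fun x s => g x (h s)).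
Proof.
move=> [b [B [q HB]]] [a [A [p HA]]].
exists (b + (a.+1 + 1)), (compose A B (@Ordinal b.+2 1 isT)), (comp_bound p q) => x s.
have le_h := computes_within_size (HA s).
have H := @computes_compose a b.+1 A B (@Ordinal b.+2 1 isT) [:: x; s] (h s) _ _ _ isT
  (HA s) (HB x (h s)).
apply: computes_within_leq H _.
rewrite -[(size x + size s)%R]/(size x + size s) comp_boundE.
rewrite -[(size x + size (h s))%R]/(size x + size (h s)).
have le_p := horner_nat_leq p (leq_addl (size x) (size s)).
have /(horner_nat_leq q) : size x + size (h s)
    <= size x + size s + p.[(size x + size s)%N]%R + 1 by move: le_h le_p => /=; lia.
move: le_h le_p => /=; lia.
Qed.

Section PushSeq.
Variable k : nat.

Definition push_seq (j : nat) (s : bits) : machine k.+1 :=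
  foldr (fun b M => seqM (push k j b) M) (skip k) s.

Lemma exec_push_seq j s S :
  exec (push_seq j s) S (upd S j (rev s ++ nth [::] S j)) (4 * size s + 1).
Proof.
elim: s S => [|b s IH] S /=.
  apply: (@exec_leq _ _ _ _ 1) => //; apply: (exec_eq (@exec_skip k S)) => l; rewrite nth_upd.
  by case: eqP => [->|].
have := exec_seq (@exec_push k j b S) (IH _) => H.
apply: (@exec_leq _ _ _ _ (3 + (4 * size s + 1) + 1)); last lia.
apply: (exec_eq H) => l; rewrite !nth_upd eqxx.
by case: eqP => // _; rewrite rev_cons cat_rcons.
Qed.

End PushSeq.

(** * The translation of circuits *)

(* The stacks of the reduction: tape 0 is the unread input, tape 1 the output *)
(* in reverse, tapes 2 and 3 are counters, and tape 4 is scratch.             *)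
Definition regs (io : bits * bits) (n w : nat) : seq bits :=
  [:: io.1; io.2; nseq n true; nseq w true; [::]].

Lemma cat_nseqS n (s : bits) : nseq n true ++ true :: s = nseq n.+1 true ++ s.
Proof. by elim: n => //= n ->. Qed.

(** Reading a counter destroys it, so a second copy goes to the scratch tape and is poured back. *)
Definition emit (j : nat) : machine 5 :=
  seqM (whileM (test_top j isSome) (seqM (pop 4 j) (seqM (push 4 4 true) (push 4 1 true))))
       (pour 4 4 j).

Lemma emit_loop j n S : j < 4 -> j != 1 -> nth [::] S j = nseq n true ->
  exec (whileM (test_top j isSome) (seqM (pop 4 j) (seqM (push 4 4 true) (push 4 1 true))))
    S (upd (upd (upd S j [::]) 4 (nseq n true ++ nth [::] S 4)) 1
         (nseq n true ++ nth [::] S 1)) (11 * n).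
Proof.
move=> lt_j ne_j1; elim: n S => [|n IH] S E.
  apply: (exec_eq (S' := S)); first by apply: exec_while_done; rewrite /top ?E //; lia.
  move=> l; rewrite !nth_upd.
  by do 3?case: eqP => [->|] //.
have H1 := exec_seq (@exec_pop 4 j S) (exec_seq (@exec_push 4 4 true _) (@exec_push 4 1 true _)).
move: H1; rewrite E; set S1 := upd _ 1 _ => H1.
have E1 : nth [::] S1 j = nseq n true.
  by rewrite !nth_upd (negbTE ne_j1) eqxx ifN //; lia.
have H := exec_while_step (j := j) (a := isSome) (leqW lt_j) _ H1 (IH _ E1).
apply: (@exec_leq _ _ _ _ (1 + (3 + 3 + 1) + 1 + 11 * n + 2)); last lia.
apply: (exec_eq (H _)) => [|l]; first by rewrite /top E.
rewrite /S1 !nth_upd.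
rewrite !(ifN_eqC _ _ ne_j1) !cat_nseqS.
have -> : (4 == j) = false by lia.
by do 3?case: eqP => //.
Qed.

Lemma catrev_nseq n (s : bits) : catrev (nseq n true) s = nseq n true ++ s.
Proof. by elim: n s => //= n IH s; rewrite IH cat_nseqS. Qed.

Lemma exec_emit2 i o n w :
  exec (emit 2) (regs (i, o) n w) (regs (i, nseq n true ++ o) n w) (20 * n + 1).
Proof.
have H1 := @emit_loop 2 n (regs (i, o) n w) isT isT erefl.
move: (exec_seq H1 (@exec_pour 4 4 2 _ isT isT)).
rewrite /regs /upd /= !cats0 catrev_nseq cats0 size_nseq => H.
by apply: exec_leq H _; lia.
Qed.

Lemma exec_emit3 i o n w :
  exec (emit 3) (regs (i, o) n w) (regs (i, nseq w true ++ o) n w) (20 * w + 1).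
Proof.
have H1 := @emit_loop 3 w (regs (i, o) n w) isT isT erefl.
move: (exec_seq H1 (@exec_pour 4 4 3 _ isT isT)).
rewrite /regs /upd /= !cats0 catrev_nseq cats0 size_nseq => H.
by apply: exec_leq H _; lia.
Qed.

(* F acts on the pair of the unread input and the reversed output.            *)
Definition transduces (c n : nat) (P : machine 5) (F : bits * bits -> bits * bits) :=
  forall io w m, size io.1 <= m ->
  exec P (regs io n w) (regs (F io) n w) (c * (n + m).+1) /\ size (F io).1 <= size io.1.

Lemma transduces_seq c1 c2 n P1 P2 F1 F2 :
  transduces c1 n P1 F1 -> transduces c2 n P2 F2 ->
  transduces (c1 + c2 + 1) n (seqM P1 P2) (fun io => F2 (F1 io)).
Proof.
move=> H1 H2 io w m le_m; have [E1 S1] := H1 io w m le_m.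
have [E2 S2] := H2 (F1 io) w m (leq_trans S1 le_m).
split; last exact: leq_trans S1.
by apply: exec_leq (exec_seq E1 E2) _; rewrite !mulnDl; lia.
Qed.

Definition top1 (io : bits * bits) := ohead io.1 == Some true.

Lemma transduces_if c1 c2 n P1 P2 F1 F2 :
  transduces c1 n P1 F1 -> transduces c2 n P2 F2 ->
  transduces (c1 + c2 + 1) n (ifM (test_top 0 (eq_op^~ (Some true))) P1 P2)
    (fun io => if top1 io then F1 io else F2 io).
Proof.
move=> H1 H2 io w m le_m; have [E1 S1] := H1 io w m le_m; have [E2 S2] := H2 io w m le_m.
split; last by case: ifP.
apply: (@exec_leq _ _ _ _ ((c1 + c2) * (n + m).+1).+1); last by rewrite !mulnDl; lia.
apply: exec_if => //; rewrite /top /= -/(top1 io).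
case: (top1 io); [apply: exec_leq E1 _ | apply: exec_leq E2 _]; rewrite mulnDl; lia.
Qed.

Definition copy_bit (io : bits * bits) := if io.1 is b :: i then (i, b :: io.2) else io.

Lemma exec_copy_bit io n w :
  exec (move_top 4 0 1) (regs io n w) (regs (copy_bit io) n w) 7.
Proof.
have := @exec_move_top 4 0 1 (regs io n w) isT.
by case: io => -[|b i] o.
Qed.

Lemma transduces_bit n : transduces 7 n (move_top 4 0 1) copy_bit.
Proof.
move=> io w m _; split; last by case: io => -[|b i] o /=.
by apply: exec_leq (@exec_copy_bit io n w) _; rewrite leq_pmulr.
Qed.

Fixpoint copy_ones (i o : bits) : bits * bits :=
  if i is true :: i' then copy_ones i' (true :: o) else (i, o).

Lemma copy_ones_size i o : size (copy_ones i o).1 <= size i.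
Proof. by elim: i o => [|[] i IH] o //=; apply: leqW. Qed.

Lemma copy_ones_nseq a i o : 
  copy_ones (nseq a true ++ false :: i) o = (false :: i, nseq a true ++ o).
Proof. by elim: a o => //= a IH o; rewrite IH cat_nseqS. Qed.

(** In unary, adding n amounts to writing n ones ahead of the copied numeral. *)
Definition copy_nat (n : nat) (io : bits * bits) : bits * bits :=
  let io' := copy_ones io.1 (nseq n true ++ io.2) in (behead io'.1, false :: io'.2).

Lemma copy_nat_encode n a i o :
  copy_nat n (encode_nat a ++ i, o) = (i, rev (encode_nat (a + n)) ++ o).
Proof.
rewrite /copy_nat /encode_nat cat_rcons copy_ones_nseq /= rev_rcons /=.
by rewrite rev_nseq nseqD catA.
Qed.

Definition copy_natM : machine 5 :=
  seqM (emit 2) (seqM (whileM (test_top 0 (eq_op^~ (Some true))) (move_top 4 0 1))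
    (seqM (push 4 1 false) (pop 4 0))).

Lemma exec_copy_ones i o n w :
  exec (whileM (test_top 0 (eq_op^~ (Some true))) (move_top 4 0 1))
    (regs (i, o) n w) (regs (copy_ones i o) n w) (9 * size i).
Proof.
elim: i o => [|b i IH] o; first exact: exec_while_done.
case: b => /=; last by apply: (@exec_leq _ _ _ _ 0) => //; apply: exec_while_done.
apply: (@exec_leq _ _ _ _ (7 + 9 * size i + 2)); last lia.
apply: exec_while_step (IH _) => //.
exact: (@exec_copy_bit (true :: i, o)).
Qed.

Lemma transduces_nat n : transduces 40 n copy_natM (copy_nat n).
Proof.
move=> -[i o] w m /= le_m; split; last first.
  by rewrite size_behead; apply: leq_trans (leq_pred _) (copy_ones_size _ _).
have H1 := exec_seq (@exec_push 4 1 false (regs (copy_ones i (nseq n true ++ o)) n w))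
  (@exec_pop 4 0 _).
have := exec_seq (@exec_emit2 i o n w) (exec_seq (@exec_copy_ones _ _ _ _) H1).
by move=> H; apply: exec_leq H _; lia.
Qed.

(** The branches follow the two tag bits of [encode_gate]: a leading 1 announces two wire names, 01
    announces one, and 00 a constant bit. *)
Definition copy_gate (n : nat) (io : bits * bits) : bits * bits :=
  if top1 io then copy_nat n (copy_nat n (copy_bit (copy_bit io)))
  else let io' := copy_bit io in
    if top1 io' then copy_nat n (copy_bit io') else copy_bit (copy_bit io').

Definition copy_gateM : machine 5 :=
  ifM (test_top 0 (eq_op^~ (Some true)))
    (seqM (seqM (seqM (move_top 4 0 1) (move_top 4 0 1)) copy_natM) copy_natM)
    (seqM (move_top 4 0 1)
      (ifM (test_top 0 (eq_op^~ (Some true)))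
        (seqM (move_top 4 0 1) copy_natM) (seqM (move_top 4 0 1) (move_top 4 0 1)))).

Lemma transduces_gate n : transduces 200 n copy_gateM (copy_gate n).
Proof.
have Hb := transduces_bit n; have Hn := transduces_nat n.
have H1 := transduces_seq (transduces_seq (transduces_seq Hb Hb) Hn) Hn.
have H2 := transduces_seq Hb (transduces_if (transduces_seq Hb Hn) (transduces_seq Hb Hb)).
move=> io w m /(transduces_if H1 H2 w)[E S]; split=> //.
by apply: exec_leq E _; lia.
Qed.

Definition shift_gate (n : nat) (g : gate) : gate :=
  match g with
  | Const b => Const b
  | Not a => Not (a + n)
  | And a b => And (a + n) (b + n)
  | Or a b => Or (a + n) (b + n)
  end.

Lemma copy_gate_encode n g i o :
  copy_gate n (encode_gate g ++ i, o) = (i, rev (encode_gate (shift_gate n g)) ++ o).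
Proof.
case: g => [b|a|a b|a b] //=; rewrite /copy_gate /= /copy_bit /=.
- by rewrite copy_nat_encode !rev_cons !cat_rcons.
- rewrite -catA !copy_nat_encode; move: (encode_nat _) (encode_nat _) => u v.
  by rewrite !rev_cons !cat_rcons rev_cat catA.
- rewrite -catA !copy_nat_encode; move: (encode_nat _) (encode_nat _) => u v.
  by rewrite !rev_cons !cat_rcons rev_cat catA.
Qed.

Lemma encode_seq_cons T (enc : T -> bits) a s (r : bits) :
  encode_seq enc (a :: s) ++ r = true :: enc a ++ encode_seq enc s ++ r.
Proof. by rewrite /encode_seq /= rcons_cat -catA. Qed.

(** With [count], tape 3 grows by one per item; this adds the number of gates to the index of the
    first appended wire. *)
Definition copy_loop (count : bool) (P : machine 5) : machine 5 :=
  whileM (test_top 0 (eq_op^~ (Some true)))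
    (seqM (move_top 4 0 1) (seqM (if count then push 4 3 true else skip 4) P)).

(* On an input that is no encoding nothing is claimed about the result, but   *)
(* the loop still halts in time.                                              *)
Lemma exec_copy_loop (count : bool) c n P F T (enc enc' : T -> bits) :
    transduces c n P F ->
    (forall a i o, F (enc a ++ i, o) = (i, rev (enc' a) ++ o)) ->
  forall m io w, size io.1 <= m -> exists io' w',
    [/\ exec (copy_loop count P) (regs io n w) (regs io' n w')
          (size io.1 * ((c + 15) * (n + m).+1)),
        size io'.1 <= size io.1, w' <= w + size io.1
      & forall s i, io.1 = encode_seq enc s ++ i ->
          io' = (false :: i, rev (flatten [seq true :: enc' a | a <- s]) ++ io.2)
          /\ w' = w + count * size s].
Proof.
move=> HP HF m io w; have [N le_N] := ubnP (size io.1).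
elim: N io le_N w => // N IH [i o] /= le_N w le_m.
have [|] := boolP (top1 (i, o)); last first.
  move=> Htop; exists (i, o), w; split=> //; last first.
  - move=> [|a s] r E; last by move: Htop; rewrite /top1 /= E encode_seq_cons.
    by rewrite (E : i = false :: r) muln0 addn0.
  - exact: leq_addr.
  - by apply: (@exec_leq _ _ _ _ 0) => //; apply: exec_while_done.
case: i le_N le_m => // -[] i //= le_N le_m _.
pose w1 := if count then w.+1 else w.
have [EP SP] := HP (i, true :: o) w1 m (ltnW le_m).
have {IH}[] := IH (F (i, true :: o)) _ w1 _.
- exact: leq_ltn_trans SP le_N.
- by apply: leq_trans SP _; apply: ltnW.
move=> io' [w' [E' S' W' spec']]; exists io', w'; split.
- have Hc : exec (if count then push 4 3 true else skip 4)
      (regs (i, true :: o) n w) (regs (i, true :: o) n w1) 3.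
    rewrite /w1; case: (count); first exact: (@exec_push 4 3 true (regs (i, true :: o) n w)).
    exact: exec_leq (@exec_skip 4 _) _.
  have H := exec_while_step (S := regs (true :: i, o) n w) (j := 0)
    (a := eq_op^~ (Some true)) isT isT
    (exec_seq (@exec_copy_bit (true :: i, o) n w) (exec_seq Hc EP)) E'.
  apply: exec_leq H _; rewrite mulSn.
  have : size (F (i, true :: o)).1 * ((c + 15) * (n + m).+1)
      <= size i * ((c + 15) * (n + m).+1) by rewrite leq_mul2r SP orbT.
  by rewrite (mulnDl c) => ?; lia.
- by apply: leq_trans S' _; apply: leqW.
- by move: SP W' => /=; rewrite /w1; case: (count); lia.
move=> [|a s] r //; rewrite encode_seq_cons => -[Ei].
have := spec' s r; rewrite Ei HF => /(_ erefl)[-> ->].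
rewrite /w1 /= rev_cons rev_cat cat_rcons -catA; split=> //.
by case: (count); rewrite ?mul1n ?mul0n ?addSnnS.
Qed.

Definition header_loop : machine 5 :=
  whileM (test_top 0 (eq_op^~ (Some true)))
    (seqM (move_top 4 0 1) (seqM (push 4 1 true) (seqM (push 4 2 true)
      (seqM (push 4 3 true) (push 4 3 true))))).

Lemma exec_header_loop i o n w : exists a r,
  [/\ i = nseq a true ++ r, ohead r != Some true
    & exec header_loop (regs (i, o) n w)
        (regs (r, nseq (2 * a) true ++ o) (n + a) (w + 2 * a)) (30 * a)].
Proof.
elim: i o n w => [|b i IH] o n w.
  by exists 0, [::]; split=> //; rewrite !addn0; apply: exec_while_done.
case: b; last first.
  by exists 0, (false :: i); split=> //; rewrite !addn0; apply: exec_while_done.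
have [a [r [-> Hr E]]] := IH [:: true, true & o] n.+1 w.+2.
exists a.+1, r; split=> //.
have H := exec_while_step (S := regs (true :: nseq a true ++ r, o) n w) (j := 0)
    (a := eq_op^~ (Some true)) isT isT
    (exec_seq (@exec_copy_bit (true :: nseq a true ++ r, o) n w)
      (exec_seq (@exec_push 4 1 true _) (exec_seq (@exec_push 4 2 true _)
        (exec_seq (@exec_push 4 3 true _) (@exec_push 4 3 true _))))) E.
move: H; rewrite !cat_nseqS => H; rewrite mulnS !addnS -!addSn.
by apply: exec_leq H _; lia.
Qed.

(** The first 1 of the numeral a + 1 is treated apart: it counts once in the output and on tape 3,
    and not on tape 2, while each later 1 counts twice, twice and once. Thus tape 2 gets the shift
    a, and the output and tape 3 get the new number of inputs 2 a + 1. *)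
Definition header : machine 5 :=
  seqM (ifM (test_top 0 (eq_op^~ (Some true)))
          (seqM (move_top 4 0 1) (push 4 3 true)) (skip 4))
    (seqM header_loop (seqM (push 4 1 false) (pop 4 0))).

Lemma exec_header x : exists io n w,
  [/\ exec header (regs (x, [::]) 0 0) (regs io n w) (50 * (size x).+1),
      size io.1 <= size x, n <= size x, w <= 2 * size x
    & forall a i, x = encode_nat a.+1 ++ i ->
        [/\ io = (i, rev (encode_nat (2 * a + 1))), n = a & w = 2 * a + 1]].
Proof.
pose io1 := if top1 (x, [::]) then (behead x, [:: true]) else (x, [::]).
pose w1 : nat := top1 (x, [::]).
have H1 : exec (ifM (test_top 0 (eq_op^~ (Some true)))
          (seqM (move_top 4 0 1) (push 4 3 true)) (skip 4))
    (regs (x, [::]) 0 0) (regs io1 0 w1) 13.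
  apply: exec_if => //; rewrite /top /= -/(top1 (x, [::])) /io1 /w1.
  case E: (top1 _); last exact: exec_leq (@exec_skip _ _) _.
  case: x E {io1 w1} => // -[] // x _.
  apply: exec_leq (exec_seq (@exec_copy_bit (true :: x, [::]) 0 0) (@exec_push 4 3 true _)) _.
  by [].
have [a [r [Ei Hr H2]]] := exec_header_loop io1.1 io1.2 0 w1.
rewrite -surjective_pairing !add0n in H2.
have H := exec_seq H1 (exec_seq H2 (exec_seq (@exec_push 4 1 false _) (@exec_pop 4 0 _))).
have le1 : size io1.1 <= size x by rewrite /io1; case: ifP => //; rewrite size_behead leq_pred.
have le_ar : a + size r <= size io1.1 by rewrite Ei size_cat size_nseq.
have le_w : w1 + size io1.1 <= size x.
  by rewrite /w1 /io1; case: ifP => //; case: (x) => //= ? ?; rewrite add1n.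
exists (behead r, false :: nseq (2 * a) true ++ io1.2), a, (w1 + 2 * a); split.
- by apply: exec_leq H _; lia.
- by rewrite size_behead; lia.
- lia.
- lia.
move=> b i Ex; have Et : top1 (x, [::]) by rewrite Ex.
rewrite /io1 /w1 Et Ex /= in Ei *.
have [Eab Er] : a = b /\ r = false :: i.
  move: Ei; rewrite cat_rcons; elim: (b) (a) => [|b' IH] [|a'] //=.
  - by move=> Er; rewrite -Er in Hr.
  - by case=> /IH[-> ->].
by rewrite Eab Er /encode_nat rev_rcons rev_nseq addn1 cat_nseqS cats0 add1n.
Qed.

(** Popping the counter lists the wires of y in decreasing order, which is why the circuit outputs y
    reversed. *)
Definition tail_loop : machine 5 :=
  whileM (test_top 2 isSome)
    (seqM (pop 4 2) (seqM (push 4 1 true) (seqM (emit 2) (push 4 1 false)))).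

Lemma exec_tail_loop i o n w :
  exec tail_loop (regs (i, o) n w)
    (regs (i, rev (flatten [seq true :: encode_nat j | j <- rev (iota 0 n)]) ++ o) 0 w)
    (n * (20 * n + 20)).
Proof.
elim: n o => [|n IH] o; first exact: exec_while_done.
have := IH (false :: nseq n true ++ true :: o).
rewrite -[in iota 0 n.+1]addn1 iotaD rev_cat /= rev_cons rev_cat rev_rcons rev_nseq.
rewrite cat_rcons -catA => H'.
have H := exec_while_step (k := 4) (S := regs (i, o) n.+1 w) (j := 2) (a := isSome) isT isT
    (exec_seq (@exec_pop 4 2 (regs (i, o) n.+1 w))
      (exec_seq (@exec_push 4 1 true (regs (i, o) n w))
       (exec_seq (@exec_emit2 i (true :: o) n w) (@exec_push 4 1 false _)))) H'.
by apply: exec_leq H _; rewrite mulSn; nia.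
Qed.

(* With n = inputs C - 1, this computes y ++ x |-> (0 C(x), 1 y^rev) for      *)
(* |y| = n.                                                                   *)
Definition turan_circuit (C : circuit) : circuit :=
  let n := (inputs C).-1 in
  let w := 2 * n + 1 + size (gates C) in
  Circuit (2 * n + 1)
    ([seq shift_gate n g | g <- gates C] ++ [:: Const false; Const true])
    (w :: [seq a + n | a <- outputs C] ++ w.+1 :: rev (iota 0 n)).

(* The two constant gates, the end of the gate list, and the marker of the    *)
(* first output.                                                              *)
Definition separator : bits :=
  flatten [seq true :: encode_gate g | g <- [:: Const false; Const true]] ++ [:: false; true].

(** The first [emit 3] names the wire of the constant false. In [[:: true; true]] the first bit
    marks a list item and the second turns the emitted numeral into its successor, the wire of the
    constant true. *)
Definition translateM : machine 5 :=
  seqM header (seqM (copy_loop true copy_gateM) (seqM (pop 4 0)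
  (seqM (push_seq 4 1 separator) (seqM (emit 3) (seqM (push 4 1 false)
  (seqM (copy_loop false copy_natM) (seqM (pop 4 0)
  (seqM (push_seq 4 1 [:: true; true]) (seqM (emit 3) (seqM (push 4 1 false)
  (seqM tail_loop (push 4 1 false)))))))))))).

Lemma exec_translate x : exists i o w,
  exec translateM (regs (x, [::]) 0 0) (regs (i, o) 0 w) (900 * (size x).+1 ^ 2) /\
  forall C, 0 < inputs C -> x = encode C ->
    i = [::] /\ o = rev (encode (turan_circuit C)).
Proof.
have [[i1 o1] [n [w1 [E1 /= le_i1 le_n le_w1 spec1]]]] := exec_header x.
have [[i2 o2] [w2 [/= E2 le_i2 le_w2 spec2]]] :=
  @exec_copy_loop true _ _ _ _ _ _ _ (transduces_gate n) (@copy_gate_encode n) _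
    (i1, o1) w1 le_i1.
pose o3 := false :: nseq w2 true ++ rev separator ++ o2.
have le_i3 : size (behead i2) <= size x by rewrite size_behead; lia.
have [[i4 o4] [w4 [/= E4 le_i4 le_w4 spec4]]] :=
  @exec_copy_loop false _ _ _ _ _ _ _ (transduces_nat n) (@copy_nat_encode n) _
    (behead i2, o3) w2 le_i3.
pose o5 := false :: nseq w4 true ++ [:: true; true] ++ o4.
have E6 := exec_seq (@exec_tail_loop (behead i4) o5 n w4) (@exec_push 4 1 false _).
set o6 := rev _ ++ o5 in E6.
have E5 := exec_seq (@exec_pop 4 0 (regs (i4, o4) n w4))
  (exec_seq (@exec_push_seq 4 1 [:: true; true] (regs (behead i4, o4) n w4))
  (exec_seq (@exec_emit3 (behead i4) ([:: true; true] ++ o4) n w4)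
  (exec_seq (@exec_push 4 1 false (regs (behead i4, nseq w4 true ++ [:: true; true] ++ o4) n w4))
  E6))).
have E3 := exec_seq (@exec_pop 4 0 (regs (i2, o2) n w2))
  (exec_seq (@exec_push_seq 4 1 separator (regs (behead i2, o2) n w2))
  (exec_seq (@exec_emit3 (behead i2) (rev separator ++ o2) n w2)
  (exec_seq (@exec_push 4 1 false (regs (behead i2, nseq w2 true ++ rev separator ++ o2) n w2))
  (exec_seq E4 E5)))).
have E := exec_seq E1 (exec_seq E2 E3).
exists (behead i4), (false :: o6), w4; split.
  apply: exec_leq E _; rewrite -mulnn.
  set m := size x in le_i1 le_n le_w1 le_i3 *.
  (* The loops cost (200 + 15) and (40 + 15) times n + m + 1 per input bit; this inequality doubles
     the constants to 430 and 110. *)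
  have le_nm : (n + m).+1 <= 2 * m.+1 by lia.
  have b2 : size i1 * ((200 + 15) * (n + m).+1) <= 430 * (m.+1 * m.+1).
    have := leq_mul (leqW le_i1) le_nm; lia.
  have b4 : size (behead i2) * ((40 + 15) * (n + m).+1) <= 110 * (m.+1 * m.+1).
    have := leq_mul (leqW le_i3) le_nm; lia.
  have b6 : n * (20 * n + 20) <= 20 * (m.+1 * m.+1).
    have := @leq_mul n (n + 1) m.+1 m.+1; lia.
  have bm : m.+1 <= m.+1 * m.+1 by rewrite leq_pmulr.
  rewrite (_ : size separator = 10) //=; lia.
move=> C C_gt0 Ex.
have Ex1 : x = encode_nat (inputs C).-1.+1 ++ encode_seq encode_gate (gates C)
    ++ encode_seq encode_nat (outputs C) by rewrite prednK.
have [[Ei1 Eo1] En Ew1] := spec1 _ _ Ex1.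
have := spec2 _ _ Ei1; case=> -[Ei2 Eo2] Ew2.
have := spec4 (outputs C) [::]; rewrite Ei2 cats0 => /(_ erefl)[[Ei4 Eo4] Ew4].
split; first by rewrite Ei4.
apply: (can_inj revK); rewrite revK /o6 /o5 Eo4 /o3 Eo2 Eo1 Ew4 Ew2 Ew1 En.
rewrite mul0n mul1n addn0 /separator !(rev_cons, rev_cat, revK, rev_nseq, rev_rcons).
rewrite /turan_circuit /encode /encode_seq /= !map_cat !flatten_cat -!map_comp /=.
rewrite /comp -!cats1 /= -!catA /=.
by rewrite /encode_nat -!cats1 -!catA.
Qed.

(** The final pour undoes the reversal of the output. *)
Definition reductionM : machine 5 := seqM translateM (pour 4 1 0).

Lemma exec_computes k (M : machine k.+1) xs S S' t : exec M S S' t ->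
  (forall j, nth [::] S j = nth [::] xs j) -> computes_within M xs (nth [::] S' 0) t.
Proof.
move=> H E; apply/computes_withinP.
have [|T' HT' h] := H xpredT (fun j : 'I_k.+1 => input_tape (nth [::] xs j)).
  by move=> j /=; rewrite E.
by exists T' => //; rewrite (HT' ord0).
Qed.

(* The output on a string that encodes no circuit is left implicit, hence f   *)
(* is obtained by choice.                                                     *)
Lemma polytime1_choice k (M : machine k.+1) (p : {poly nat}) (Q : bits -> bits -> Prop) :
  (forall x, exists y, computes_within M [:: x] y p.[size x]%R /\ Q x y) ->
  exists2 f, polytime1 f & forall x, Q x (f x).
Proof.
move=> H; pose f x := proj1_sig (constructive_indefinite_description _ (H x)).
have fP x : computes_within M [:: x] (f x) p.[size x]%R /\ Q x (f x).
  exact: proj2_sig (constructive_indefinite_description _ (H x)).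
by exists f; [exists k, M, p => x; case: (fP x) | move=> x; case: (fP x)].
Qed.

Definition quad_bound (c : nat) : {poly nat} := (c%:P * ('X + 1%:P) ^+ 2)%R.

Lemma quad_boundE c (n : nat) : (quad_bound c).[n]%R = c * n.+1 ^ 2.
Proof.
by rewrite hornerM hornerC GRing.expr2 hornerM hornerD hornerX hornerC -addn1 -mulnn.
Qed.

Lemma polytime1_reduction : exists2 f, polytime1 f &
  forall C, 0 < inputs C -> f (encode C) = encode (turan_circuit C).
Proof.
have [|f f_poly fP] := @polytime1_choice 4 reductionM
    (quad_bound (100 * 91))
    (fun x y => forall C, 0 < inputs C -> x = encode C -> y = encode (turan_circuit C)).
  move=> x; have [i [o [w [E spec]]]] := exec_translate x.
  (* The time bound must also hold when x encodes no circuit, where only the running time limits the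
     length of o. Pouring costs 9 steps per bit, whence a constant slightly above 900 + 9 * 900. *)
  have le_o := exec_size (j := 1) E isT.
  have H := exec_seq E (@exec_pour 4 1 0 (regs (i, o) 0 w) isT isT).
  exists (catrev o i); split.
    apply: computes_within_leq (exec_computes H _) _.
      by move=> [|[|[|[|[|j]]]]] //=; rewrite ?nth_nil.
    by rewrite quad_boundE; move: le_o; rewrite /= -mulnn; nia.
  by move=> C C_gt0 /(spec C C_gt0)[-> ->]; rewrite catrevE revK cats0.
by exists f => // C C_gt0; apply: (fP _ C).
Qed.

(** * Recovering the collision *)

(** Division by 4: bits are moved four at a time, and only complete groups are counted on tape 2.
    The string ends up reversed on tape 1. *)
Definition extract_count : machine 4 :=
  whileM (test_top 0 isSome) (seqM (move_top 3 0 1) (seqM (move_top 3 0 1)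
    (seqM (move_top 3 0 1)
      (ifM (test_top 0 isSome) (seqM (move_top 3 0 1) (push 3 2 true)) (skip 3))))).

Lemma exec_extract_count s a q :
  exec extract_count [:: s; a; nseq q true; [::]]
    [:: [::]; rev s ++ a; nseq (q + size s %/ 4) true; [::]] (50 * size s).
Proof.
have step_count s0 a0 q0 : exec (seqM (move_top 3 0 1) (seqM (move_top 3 0 1)
    (seqM (move_top 3 0 1)
      (ifM (test_top 0 isSome) (seqM (move_top 3 0 1) (push 3 2 true)) (skip 3)))))
    [:: s0; a0; nseq q0 true; [::]]
    [:: drop 4 s0; rev (take 4 s0) ++ a0; nseq (q0 + (3 < size s0)) true; [::]] 48.
  have mv s1 a1 c1 : exec (move_top 3 0 1) [:: s1; a1; c1; [::]]
      [:: drop 1 s1; rev (take 1 s1) ++ a1; c1; [::]] 7.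
    have := @exec_move_top 3 0 1 [:: s1; a1; c1; [::]] isT.
    by case: s1 => [|b s1] //=; rewrite drop0 take0.
  have Hif s1 a1 : exec (ifM (test_top 0 isSome) (seqM (move_top 3 0 1) (push 3 2 true)) (skip 3))
    [:: s1; a1; nseq q0 true; [::]]
    [:: drop 1 s1; rev (take 1 s1) ++ a1; nseq (q0 + (0 < size s1)) true; [::]] 12.
    apply: exec_if => //; rewrite /top /=; case: s1 => [|b s1] /=.
      by rewrite addn0; apply: exec_leq (@exec_skip _ _) _.
    rewrite addn1; exact: exec_seq (mv _ _ _) (@exec_push 3 2 true _).
  have H := exec_seq (mv s0 a0 _) (exec_seq (mv _ _ _) (exec_seq (mv _ _ _) (Hif _ _))).
  move: H; rewrite !drop_drop.
  case: s0 => [|b1 [|b2 [|b3 [|b4 s0]]]] /=; rewrite ?drop0 ?take0 => H; exact: exec_leq H _.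
have [N] := ubnP (size s); elim: N s a q => // N IH s a q le_N.
have [->|s_neq0] := eqVneq s [::].
  by rewrite addn0; apply: exec_while_done.
have lt_d : size (drop 4 s) < N.
  by rewrite size_drop; case: (s) s_neq0 le_N => //= b s1 _; lia.
have H := exec_while_step (k := 3) (j := 0) (a := isSome) (S := [:: s; a; nseq q true; [::]])
  isT _ (step_count _ _ _) (IH _ _ _ lt_d).
have {}H := H _; move: H; rewrite catA -rev_cat cat_take_drop size_drop -addnA.
have -> : (3 < size s) + (size s - 4) %/ 4 = size s %/ 4 by lia.
move=> H; apply: exec_leq (H _) _; first by case: (s) s_neq0.
have : 0 < size s by rewrite lt0n size_eq0.
lia.
Qed.

(** The counter migrates to tape 3 while it is used; [extract_drop] brings it back to tape 2 for the
    next pass. *)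
Definition extract_take : machine 4 :=
  whileM (test_top 2 isSome) (seqM (pop 3 2) (seqM (push 3 3 true) (move_top 3 1 0))).

Lemma exec_extract_take r a q p :
  exec extract_take [:: r; a; nseq q true; nseq p true]
    [:: rev (take q a) ++ r; drop q a; [::]; nseq (q + p) true] (15 * q).
Proof.
elim: q r a p => [|q IH] r a p.
  by rewrite take0 drop0; apply: exec_while_done.
have H := exec_while_step (k := 3) (j := 2) (a := isSome)
  (S := [:: r; a; nseq q.+1 true; nseq p true]) isT isT
  (exec_seq (@exec_pop 3 2 [:: r; a; nseq q.+1 true; nseq p true])
    (exec_seq (@exec_push 3 3 true [:: r; a; nseq q true; nseq p true])
      (@exec_move_top 3 1 0 [:: r; a; nseq q true; nseq p.+1 true] isT))).
rewrite addSnnS; case: a H => [|b a] H.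
  by apply: exec_leq (H _ _ (IH r [::] p.+1)) _; rewrite /=; lia.
rewrite /= rev_cons cat_rcons.
by apply: exec_leq (H _ _ (IH _ a p.+1)) _; rewrite /=; lia.
Qed.

Definition extract_drop : machine 4 :=
  whileM (test_top 3 isSome) (seqM (pop 3 3) (seqM (push 3 2 true) (pop 3 1))).

Lemma exec_extract_drop r a q p :
  exec extract_drop [:: r; a; nseq p true; nseq q true]
    [:: r; drop q a; nseq (q + p) true; [::]] (10 * q).
Proof.
elim: q a p => [|q IH] a p.
  by rewrite drop0; apply: exec_while_done.
have H := exec_while_step (k := 3) (j := 3) (a := isSome)
  (S := [:: r; a; nseq p true; nseq q.+1 true]) isT isT
  (exec_seq (@exec_pop 3 3 [:: r; a; nseq p true; nseq q.+1 true])
    (exec_seq (@exec_push 3 2 true [:: r; a; nseq p true; nseq q true])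
      (@exec_pop 3 1 [:: r; a; nseq p.+1 true; nseq q true]))) (IH (behead a) p.+1).
rewrite addSnnS (_ : drop q.+1 a = drop q (behead a)); last by case: (a).
by apply: exec_leq H _; lia.
Qed.

(** The single [move_top] before each [extract_take] accounts for x being one bit longer than y. *)
Definition extractM : machine 4 :=
  seqM extract_count (seqM (move_top 3 1 0) (seqM extract_take (seqM extract_drop
    (seqM (move_top 3 1 0) extract_take)))).

(* On strings of length 2 (2 n + 1), for which size s %/ 4 = n, this drops    *)
(* the first n bits of each half.                                             *)
Definition extract (s : bits) : bits :=
  let q := size s %/ 4 in
  let a := rev s in
  rev (take q.+1 (drop (q.+1 + q) a)) ++ rev (take q.+1 a).

Lemma extractE s : let q := size s %/ 4 in let a := rev s in
  let a' := drop q (drop q (drop 1 a)) in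
  extract s = rev (take q (drop 1 a')) ++ rev (take 1 a')
    ++ rev (take q (drop 1 a)) ++ rev (take 1 a).
Proof.
move=> q a a'; have takeS (b : bits) : take q.+1 b = take 1 b ++ take q (drop 1 b).
  by case: b => [|c b] //=; rewrite take0 drop0.
have Ea' : drop (q.+1 + q) a = a' by rewrite /a' !drop_drop; congr drop; lia.
by rewrite /extract -/q -/a Ea' !takeS !rev_cat -!catA.
Qed.

Lemma polytime1_extract : polytime1 extract.
Proof.
exists 3, extractM, (quad_bound 200) => s.
rewrite quad_boundE -mulnn.
have xsE j : nth [::] [:: s; [::]; nseq 0 true; [::]] j = nth [::] [:: s] j.
  by case: j => [|[|[|[|j]]]] //=; rewrite ?nth_nil.
have H0 := @exec_extract_count s [::] 0.
have mv r1 a1 c1 d1 : exec (move_top 3 1 0) [:: r1; a1; c1; d1]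
    [:: rev (take 1 a1) ++ r1; drop 1 a1; c1; d1] 7.
  have := @exec_move_top 3 1 0 [:: r1; a1; c1; d1] isT.
  by case: a1 => [|b a1] //=; rewrite drop0 take0.
have H := exec_seq H0 (exec_seq (mv _ _ _ _) (exec_seq (@exec_extract_take _ _ _ 0)
  (exec_seq (@exec_extract_drop _ _ _ 0) (exec_seq (mv _ _ _ _) (@exec_extract_take _ _ _ 0))))).
rewrite !addn0 !add0n !cats0 in H.
have {}H := exec_computes (xs := [:: s]) H.
have {}H := H xsE.
rewrite extractE; apply: computes_within_leq H _.
have le_q : size s %/ 4 <= size s by apply: leq_div.
have le_m : (size s).+1 <= (size s).+1 * (size s).+1 by rewrite leq_pmulr.
lia.
Qed.

(** * Evaluation of the translated circuit *)

Lemma size_wire_values gs x : size (wire_values gs x) = size x + size gs.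
Proof.
rewrite /wire_values; elim: gs x => [|g gs IH] x /=; first by rewrite addn0.
by rewrite IH size_rcons addSnnS.
Qed.

(** The shift makes every gate read past y, at the position that it read before; reads beyond the
    end give the default on both sides. *)
Lemma wire_values_shift gs y x :
  wire_values [seq shift_gate (size y) g | g <- gs] (y ++ x) = y ++ wire_values gs x.
Proof.
rewrite /wire_values; elim: gs x => //= g gs IH x; rewrite -IH -rcons_cat.
congr (foldl _ (rcons _ _) _).
by case: g => [b|a|a b|a b] //=; rewrite !nth_cat !ltnNge !leq_addl /= !addnK.
Qed.

Lemma eval_turan_circuit C y x : wf_circuit C ->
  size x = inputs C -> size y = (inputs C).-1 -> 0 < inputs C ->
  eval_circuit (turan_circuit C) (y ++ x) = (false :: eval_circuit C x) ++ true :: rev y.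
Proof.
move=> /andP[_ /allP wf_out] size_x size_y C_gt0.
have size_D : 2 * (inputs C).-1 + 1 + size (gates C) = size (y ++ wire_values (gates C) x).
  by rewrite size_cat size_wire_values size_x size_y; lia.
rewrite /eval_circuit /turan_circuit /= size_D.
have -> : wire_values ([seq shift_gate (inputs C).-1 g | g <- gates C]
    ++ [:: Const false; Const true]) (y ++ x)
    = (y ++ wire_values (gates C) x) ++ [:: false; true].
  rewrite /wire_values foldl_cat -!/(wire_values _ _) -size_y wire_values_shift /=.
  by rewrite -!cats1 -!catA.
set V := y ++ _; rewrite !map_cat /= !nth_cat ltnn subnn /= ltnNge leqnSn /= subSnn /=.
congr (_ :: _ ++ _ :: _).
  rewrite -map_comp; apply/eq_in_map => a /wf_out lt_a /=.
  (* Well-formedness of C keeps the shifted output wires below the two appended constants. *)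
  rewrite nth_cat ifT; last by rewrite size_cat size_wire_values size_x size_y; lia.
  by rewrite nth_cat ltnNge -size_y leq_addl /= addnK.
rewrite map_rev; congr rev; rewrite -size_y; apply: (@eq_from_nth _ false).
  by rewrite size_map size_iota.
rewrite size_map size_iota => j lt_j; rewrite (nth_map 0) ?size_iota // nth_iota // add0n.
by rewrite nth_cat size_cat ltn_addr // nth_cat lt_j.
Qed.

Lemma wf_gates_cat w gs1 gs2 :
  wf_gates w (gs1 ++ gs2) = wf_gates w gs1 && wf_gates (w + size gs1) gs2.
Proof. by elim: gs1 w => [|g gs IH] w /=; rewrite ?addn0 // IH addSnnS andbA. Qed.

Lemma wf_gates_shift n w gs :
  wf_gates w gs -> wf_gates (w + n) [seq shift_gate n g | g <- gs].
Proof.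
elim: gs w => //= g gs IH w /andP[wf_g /IH]; rewrite addSn => ->; rewrite andbT.
by case: g wf_g => [b|a|a b|a b] //=; rewrite !ltn_add2r.
Qed.

Lemma is_circuit_turan C n : 0 < n -> is_circuit C n (n - 1) ->
  is_circuit (turan_circuit C) (2 * n - 1) (2 * n).
Proof.
move=> n_gt0 /and3P[/andP[wf_g wf_o] /eqP En /eqP size_o].
apply/and3P; split; rewrite /= ?En.
- apply/andP; split; rewrite /= ?En.
    rewrite wf_gates_cat /= andbT.
    by have := @wf_gates_shift n.-1 _ _ wf_g; rewrite En; congr wf_gates; lia.
  rewrite all_cat /= !size_cat !size_map /= all_rev.
  apply/and4P; split; try lia.
    rewrite all_map; apply: sub_all wf_o => a /=; rewrite En; lia.
  by apply/allP=> a; rewrite mem_iota; lia.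
- by apply/eqP; lia.
- rewrite size_cat /= size_map size_rev size_iota size_o; apply/eqP; lia.
Qed.

Lemma extract_cat n y1 x1 y2 x2 : size y1 = n -> size x1 = n.+1 ->
  size y2 = n -> size x2 = n.+1 ->
  extract ((y1 ++ x1) ++ (y2 ++ x2)) = x1 ++ x2.
Proof.
move=> Ey1 Ex1 Ey2 Ex2; rewrite /extract.
have -> : size ((y1 ++ x1) ++ y2 ++ x2) %/ 4 = n.
  by rewrite !size_cat Ey1 Ex1 Ey2 Ex2; lia.
rewrite !rev_cat -!catA.
congr (_ ++ _); last by rewrite take_size_cat ?revK ?size_rev.
rewrite catA drop_size_cat; last by rewrite size_cat !size_rev Ey2 Ex2.
by rewrite take_size_cat ?revK ?size_rev.
Qed.

(** * Correctness of the reduction *)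

Theorem theorem8p12 : forall r : nat, 2 <= r -> PWPP_hard (weak_turan r).
Proof.
move=> r r_ge2 R [_ [f [g [f_poly g_poly fgP]]]].
have [h h_poly hE] := polytime1_reduction.
exists (fun x => h (f x)), (fun x s => g x (extract s)); split.
- exact: polytime1_comp.
- exact: polytime2_comp g_poly polytime1_extract.
(* Unfolding [weak_pigeon] leaves only the case in which f x encodes a circuit of the right
   shape. *)
move=> x s sol; apply: fgP => n C n_gt0 circ Ex.
have /and3P[wf /eqP En _] := circ.
have C_gt0 : 0 < inputs C by rewrite En.
have split_input i : size i = 2 * n - 1 -> exists y z,
    [/\ i = y ++ z, size y = n.-1, size z = n
      & edge n (turan_circuit C) i = (false :: eval_circuit C z, true :: rev y)].
  move=> size_i; exists (take n.-1 i), (drop n.-1 i).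
  have size_y : size (take n.-1 i) = n.-1 by rewrite size_takel //; lia.
  have size_z : size (drop n.-1 i) = n by rewrite size_drop; lia.
  split=> //; first by rewrite cat_take_drop.
  rewrite /edge -{1 2}(cat_take_drop n.-1 i) eval_turan_circuit ?En //.
  have size_u : size (false :: eval_circuit C (drop n.-1 i)) = n.
    by have /and3P[_ _ /eqP] := circ; rewrite /= size_map => ->; lia.
  by rewrite take_size_cat // drop_size_cat.
have := sol n (turan_circuit C) n_gt0 (is_circuit_turan n_gt0 circ).
rewrite Ex hE // => /(_ erefl)[[idx [_ /allP size_idx _ _ [K [K_uniq K_size _ K_edges]]]]
  | [i [_ size_i]] | [i [j [-> size_i size_j ne_ij]]]].
- have heads_edge u v : (u, v) \in [seq edge n (turan_circuit C) i | i <- idx] ->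
      ohead u = Some false /\ ohead v = Some true.
    by case/mapP=> i /size_idx/eqP/split_input[y [z [_ _ _ ->]]] [-> ->].
  (* As r >= 2, the clique has three distinct vertices. Each pair of them would need different
     leading bits, which is impossible for bits. *)
  case: K K_uniq K_size K_edges => [|u [|v [|w K]]] /=; try by move=> *; lia.
  rewrite !inE !negb_or -!andbA => /and5P[ne_uv ne_uw _ ne_vw _] _ K_edges.
  have := K_edges u v; have := K_edges u w; have := K_edges v w.
  rewrite !inE !eqxx !orbT => /(_ isT isT ne_vw) H1
    /(_ isT isT ne_uw) H2 /(_ isT isT ne_uv) H3.
  by case: H1 H2 H3 => /heads_edge[? ?] [] /heads_edge[? ?] [] /heads_edge[? ?]; congruence.
(* The first endpoint starts with 0 and the second with 1, so the lexicographic comparison computes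
   to false. *)
- by have [y [z [_ _ _ ->]]] := split_input i size_i.
have [y1 [x1 [Ei size_y1 size_x1 ->]]] := split_input i size_i.
have [y2 [x2 [Ej size_y2 size_x2 ->]]] := split_input j size_j.
case=> eq_eval /(can_inj revK) eq_y; exists x1, x2; split=> //.
- by rewrite Ei Ej (@extract_cat n.-1) // prednK.
(* The edges already determine y, so equal x-parts would make the two indices equal. *)
- by apply: contra_neq ne_ij => eq_x; rewrite Ei Ej eq_y eq_x.
Qed.
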